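(* Let $U \subset \mathbb{R}$ be a bounded interval, let $K>0$, and let $f,g \in \mathcal{S}_K(U)$. Put $\varepsilon := \|P_f-P_g\|_\ast$. Then $$\rho(A^{[f]},A^{[g]}) \ge \frac{\varepsilon\,(e^{\varepsilon/4}-1)(e^{\varepsilon/6}-1)}{16K \exp(\|P_f\|_\ast)\left(e^{K|U|}-1\right)}.$$
   Context: Intervals are nondegenerate and $|U|$ denotes the length of $U$. Quasi-arithmetic means: for a continuous, strictly monotone $f\colon U\to\mathbb{R}$, a tuple $a=(a_1,\dots,a_n)\in U^n$ ($n\in\mathbb{N}$) and weights $w=(w_1,\dots,w_n)$ with $w_i>0$, $\sum_i w_i=1$, put $A^{[f]}(a,w):=f^{-1}\left(\sum_{i=1}^n w_i f(a_i)\right)$. For two such functions $f,g$ on the same $U$, $\rho(A^{[f]},A^{[g]}):=\sup |A^{[f]}(a,w)-A^{[g]}(a,w)|$, where the supremum is over all $n$, all $a\in U^n$ and all such weights $w$ of length $n$. $\mathcal{S}(U)$ is the set of twice differentiable functions $f\colon U\to\mathbb{R}$ with nowhere vanishing first derivative; for $f\in\mathcal{S}(U)$, $P_f:=f''/f'$ (so $P_f\colon U\to\mathbb{R}$). For $K>0$, $\mathcal{S}_K(U):=\{f\in\mathcal{S}(U)\colon \|P_f\|_\infty\le K\}$, where $\|P_f\|_\infty=\sup_{x\in U}|P_f(x)|$. For a function $u\colon U\to\mathbb{R}$ (integrable on compact subintervals), $\|u\|_\ast:=\sup_{x,y\in U}\left|\int_x^y u(t)\,dt\right|$. *)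

(* Defs.v *)
(* MathComp-Analysis development over an abstract [R : realType]. *)
From HB Require Import structures.
From mathcomp Require Import all_boot all_order all_algebra.
From mathcomp Require Import all_classical all_reals all_analysis.

Set Implicit Arguments.
Unset Strict Implicit.
Unset Printing Implicit Defensive.

Import Order.TTheory GRing.Theory Num.Theory.
Import numFieldNormedType.Exports.

Local Open Scope classical_set_scope.
Local Open Scope ring_scope.

(* A function on U is a total function R -> R of which only the values on U
   are ever used; U is an arbitrary (open, closed or half-open) interval. *)

Definition nondegenerate_interval {R : realType} (U : set R) : Prop :=
  is_interval U /\ exists x y, [/\ U x, U y & x < y].

(* Meaningful for nonempty bounded U. *)
Definition interval_length {R : realType} (U : set R) : R := sup U - inf U.

(* Differentiation relative to U: the library's [derive1] is two-sided, whereas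
   at an endpoint belonging to U the derivative has to be one-sided. *)
Definition derivable_in {R : realType} (U : set R) (f : R -> R) (x : R) : Prop :=
  cvg ((f y - f x) / (y - x) @[y --> within U x^']).

Definition derive_in {R : realType} (U : set R) (f : R -> R) (x : R) : R :=
  lim ((f y - f x) / (y - x) @[y --> within U x^']).

Definition S_class {R : realType} (U : set R) : set (R -> R) :=
  [set f | forall x, U x -> [/\ derivable_in U f x,
                                derivable_in U (derive_in U f) x
                              & derive_in U f x != 0]].

Definition P_op {R : realType} (U : set R) (f : R -> R) (x : R) : R :=
  derive_in U (derive_in U f) x / derive_in U f x.

Definition supnorm {R : realType} (U : set R) (u : R -> R) : \bar R :=
  ereal_sup [set `|u x|%:E | x in U].

Definition S_bounded {R : realType} (K : R) (U : set R) : set (R -> R) :=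
  [set f | S_class U f /\ (supnorm U (P_op U f) <= K%:E)%E].

(* Lebesgue integral, since P_op U f may fail to be Riemann integrable. *)
Definition oriented_integral {R : realType} (u : R -> R) (x y : R) : R :=
  if x <= y then \int[lebesgue_measure]_(t in `[x, y]) u t
  else - \int[lebesgue_measure]_(t in `[y, x]) u t.

Definition starnorm {R : realType} (U : set R) (u : R -> R) : \bar R :=
  ereal_sup [set r | exists x y,
    [/\ U x, U y & r = `|oriented_integral u x y|%:E]].

Definition qamean {R : realType} (U : set R) (f : R -> R) (n : nat)
    (a w : 'I_n -> R) : R :=
  'pinv_(fun=> 0) U f (\sum_(i < n) w i * f (a i)).

Definition qadist {R : realType} (U : set R) (f g : R -> R) : \bar R :=
  ereal_sup [set r | exists (n : nat) (a w : 'I_n -> R),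
    [/\ forall i, U (a i), forall i, 0 < w i, \sum_(i < n) w i = 1
      & r = `|qamean U f a w - qamean U g a w|%:E]].

(* Main.v *)
Require Import Defs.
From HB Require Import structures.
From mathcomp Require Import all_boot all_order all_algebra.
From mathcomp Require Import all_classical all_reals all_analysis.
From mathcomp Require Import measurable_realfun ring lra.
Import Order.TTheory GRing.Theory Num.Theory.
Import numFieldNormedType.Exports.
Local Open Scope classical_set_scope.
Local Open Scope ring_scope.

(** Write [h = ln|f'| - ln|g'|], so that [P_f - P_g = h'] and [eps] is the
    oscillation of [h] over [U]; likewise the star norm [N] of [P_f] is the
    oscillation of [ln|f'|].  Both facts need the fundamental theorem of calculus for a
    derivative that is merely bounded ([Rintegral_derivative]), because [P_f]
    need not be continuous.

    Choose [a < b] in [U] with [eta = |h b - h a|] close to [eps], and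
    normalise [f] and [g] affinely to [F] and [G], running from [0] to [1] on
    the segment from [a] to [b].  Then [F' / G' = exp (h - c)] for a constant
    [c].  The values of [h] at [a] and [b] are [eta] apart, so at one endpoint [e] we have
    [|h e - c| >= eta / 2].  As [h] is [2K]-Lipschitz, [h - c] keeps its sign
    and stays of size at least [eta / 4] over the distance
    [d = eta / (8 K)] from [e]; there [F'] and [G'] differ by at least the
    factor [1 - exp (- eta / 4)] times [F'].  Since [F - G] vanishes at [e],
    the mean value theorem bounds [|F - G|] from below at the point [y] at
    distance [d] from [e] ([normalized_gap]).

    Consider now the mean of [a] and [b] with weights [1 - G y] and [G y].  Its
    [g]-mean is [y]; its [f]-mean is the point [x] with [F x = G y], and
    [|F y - G y| = |F y - F x| = F'(zeta) |x - y|] ([two_point_mean_gap]).  Two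
    values of [F'] have ratio at least [exp (- N)], whence
    [qadist_lower]:
      [rho >= eta / (8 K) * (1 - exp (- eta / 4)) * exp (- N)].

    This is stronger than the claim, since [eps <= 2 K |U|]; there is even
    enough room to take [eta] anywhere above [2 eps / 3] instead of letting it
    tend to [eps] ([constant_compare]), so it does not matter that the supremum
    defining [eps] may not be attained. *)

(** * The fundamental theorem of calculus for bounded derivatives *)

Lemma cvg_difference_quotients (R : realType) (F : R -> R) (t l : R) :
  is_derive t 1 F l ->
  (F (t + harmonic n) - F t) / harmonic n @[n --> \oo] --> l.
Proof.
move=> [dF <-].
have /cvg_at_rightP/(_ harmonic) H := cvg_dnbhs_at_right dF.
have -> : (fun n => (F (t + harmonic n) - F t) / harmonic n) =
   (fun n => (harmonic n)^-1 *: ((F \o shift t) (harmonic n *: 1) - F t)).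
  by apply/funext => n; rewrite /= /GRing.scale /= mulr1 (addrC t) mulrC.
apply: H; split; last exact: cvg_harmonic.
by move=> n; exact: harmonic_gt0.
Qed.

Lemma lipschitz_of_bounded_derivative (R : realType) (p dp : R -> R) (x y M : R) :
  {within `[x, y], continuous p} ->
  (forall t, t \in `]x, y[ -> is_derive t 1 p (dp t)) ->
  (forall t, t \in `]x, y[ -> `|dp t| <= M) ->
  forall s t, s \in `[x, y] -> t \in `[x, y] -> `|p s - p t| <= M * `|s - t|.
Proof.
move=> cp dpP dpM s t; wlog : s t / s <= t.
  move=> H sI tI; have [st|/ltW ts] := leP s t; first exact: H.
  by rewrite distrC (distrC s); exact: H.
rewrite le_eqVlt => /predU1P[->|st]; first by rewrite !subrr normr0 mulr0.
rewrite !in_itv /= => /andP[xs sy] /andP[xt ty].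
have sub u : u \in `]s, t[ -> u \in `]x, y[.
  by rewrite !in_itv /= => /andP[su ut]; rewrite (le_lt_trans xs)// (lt_le_trans ut).
have dpst u (us : u \in `]s, t[) : is_derive u 1 p (dp u) by exact/dpP/sub.
have cpst : {within `[s, t], continuous p}.
  apply: continuous_subspaceW cp => u /=; rewrite !in_itv /= => /andP[su ut].
  by rewrite (le_trans xs)// (le_trans ut).
have [c cst E] := MVT st dpst cpst.
rewrite distrC E normrM (distrC s) ler_wpM2r// dpM//; exact: sub.
Qed.

Definition clamp {R : realType} (x y t : R) := Num.max x (Num.min t y).

Lemma clamp_id (R : realType) (x y t : R) : t \in `[x, y] -> clamp x y t = t.
Proof.
by rewrite in_itv /= => /andP[xt ty]; rewrite /clamp min_l// max_r.
Qed.

Lemma clamp_in (R : realType) (x y t : R) : x <= y -> clamp x y t \in `[x, y].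
Proof.
by move=> xy; rewrite in_itv/= /clamp le_max lexx/= ge_max xy ge_min lexx orbT.
Qed.

Lemma maxr_lip (R : realType) (x s t : R) :
  `|Num.max x s - Num.max x t| <= `|s - t|.
Proof.
have n1 := ler_norm (s - t); have n2 := ler_norm (t - s).
rewrite distrC in n2; rewrite ler_norml !maxEle.
by case: (leP x s) => ?; case: (leP x t) => ?; apply/andP; split; lra.
Qed.

Lemma minr_lip (R : realType) (y s t : R) :
  `|Num.min s y - Num.min t y| <= `|s - t|.
Proof.
have n1 := ler_norm (s - t); have n2 := ler_norm (t - s).
rewrite distrC in n2; rewrite ler_norml !minEle.
by case: (leP s y) => ?; case: (leP t y) => ?; apply/andP; split; lra.
Qed.

Lemma clamp_lip (R : realType) (x y s t : R) :
  `|clamp x y s - clamp x y t| <= `|s - t|.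
Proof. exact: le_trans (maxr_lip _ _ _ _) (minr_lip _ _ _ _). Qed.

(** The difference quotients of [p] along steps [1 / (n + 1)] converge to [dp]
    and are bounded by [M], so dominated convergence applies; the integral of
    each quotient is a difference of averages of the continuous function [p]
    over shrinking intervals at [y] and [x], and tends to [p y - p x]. *)
Lemma Rintegral_derivative (R : realType) (p dp : R -> R) (x y M : R) :
  x < y -> {within `[x, y], continuous p} ->
  (forall t, t \in `]x, y[ -> is_derive t 1 p (dp t)) ->
  (forall t, t \in `]x, y[ -> `|dp t| <= M) ->
  \int[lebesgue_measure]_(t in `[x, y]) dp t = p y - p x.
Proof.
move=> xy cp dpP dpM.
have plip := lipschitz_of_bounded_derivative R p dp x y M cp dpP dpM.
have M0 : 0 <= M.
  have /dpM : (x + y) / 2 \in `]x, y[ by rewrite in_itv/= midf_lt//= midf_lt.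
  exact: le_trans.
(* Extending [p] by constants keeps the quotients near [y] meaningful. *)
pose q t := p (clamp x y t).
have qlip s t : `|q s - q t| <= M * `|s - t|.
  apply: le_trans (ler_wpM2l M0 (clamp_lip R x y s t)).
  by apply: plip; exact/clamp_in/ltW.
have qc : continuous q.
  move=> t; apply/cvgrPdist_le => e e0; near=> s.
  rewrite (le_trans (qlip _ _))// (@le_trans _ _ ((M + 1) * `|t - s|))//.
    by rewrite ler_wpM2r// lerDl.
  rewrite mulrC -ler_pdivlMr ?ltr_wpDl//; near: s.
  by apply: cvgr_dist_le; [exact: cvg_id|rewrite divr_gt0// ltr_wpDl].
(* A base point left of [x] makes [Q] differentiable at [x] itself. *)
pose Q t := \int[lebesgue_measure]_(s in `[x - 1, t]) q s.
have Qd t : x - 1 < t -> is_derive t 1 Q (q t).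
  move=> xt; have [||//|dQ Q'] := @continuous_FTC1_closed R q (x - 1) t (t + 1) _ _ xt.
  - by rewrite ltrDl.
  - apply: continuous_compact_integrable; first exact: segment_compact.
    exact: continuous_subspaceT.
  - exact: qc.
  - by apply: DeriveDef => //; rewrite -derive1E.
pose d n t := (q (t + harmonic n) - q t) / harmonic n.
pose D n t := (Q (t + harmonic n) - Q t) / harmonic n.
have Dd n t : x - 1 < t -> is_derive t 1 (D n) (d n t).
  move=> xt; have h0 : 0 < harmonic n :> R by exact: harmonic_gt0.
  have xt' : x - 1 < t + harmonic n by rewrite ltr_wpDr// ltW.
  have /= d1 := Qd _ xt; have /= d2 := Qd _ xt'.
  have d3 : is_derive t 1 (Q \o shift (harmonic n)) (q (t + harmonic n) * 1).
    apply: is_derive1_comp; exact: is_derive_shift.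
  have -> : D n = (harmonic n)^-1 \*: (Q \o shift (harmonic n) - Q).
    by apply/funext => u; rewrite /D /= mulrC.
  apply: is_derive_eq.
  by rewrite /d mulr1 /GRing.scale/= mulrC.
have dc n : continuous (d n).
  move=> t; apply: cvgMl; apply: cvgB; last exact: qc.
  apply: (@cvg_comp _ _ _ (shift (harmonic n)) q _ (nbhs (t + harmonic n))).
    by apply: cvgD; [exact: cvg_id|exact: cvg_cst].
  exact: qc.
have intd n : (\int[lebesgue_measure]_(t in `[x, y]) (d n t)%:E = (D n y - D n x)%:E)%E.
  have Dx t : x <= t -> {for t, continuous (D n)}.
    move=> xt; apply/differentiable_continuous/derivable1_diffP.
    by have [] := Dd n t; first lra.
  rewrite (@continuous_FTC2 R (d n) (D n))//.
  - exact: continuous_subspaceT.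
  - split.
    + by move=> t; rewrite in_itv/= => /andP[xt _]; have [] := Dd n t; first lra.
    + by apply: cvg_at_right_filter; exact: Dx.
    + by apply: cvg_at_left_filter; apply: Dx; rewrite ltW.
  - move=> t; rewrite in_itv/= => /andP[xt _]; rewrite derive1E.
    by have [] := Dd n t; first lra.
have limD : D n y - D n x @[n --> \oo] --> p y - p x.
  have -> : p y = q y by rewrite /q clamp_id// in_itv/= lexx ltW.
  have -> : p x = q x by rewrite /q clamp_id// in_itv/= lexx ltW.
  by apply: cvgB; apply: cvg_difference_quotients; apply: Qd; lra.
have limd t : t \in `]x, y[ -> d n t @[n --> \oo] --> dp t.
  move=> txy; apply: cvg_difference_quotients.
  apply: near_eq_is_derive (dpP t txy).
  have : \forall s \near t, s \in `]x, y[ by exact: near_in_itvoo.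
  apply: filterS => s; rewrite !in_itv/= /q => /andP[xs sy].
  by rewrite clamp_id// in_itv/= !ltW.
have md n : measurable_fun `]x, y[ (d n).
  by apply: measurable_funTS; exact: continuous_measurable_fun.
have mdp : measurable_fun `]x, y[ dp.
  exact: (@measurable_fun_cvg _ _ _ _ d).
have {}md n : measurable_fun `]x, y[ (fun t => (d n t)%:E).
  exact/measurable_EFinP.
have {}mdp : measurable_fun `]x, y[ (fun t => (dp t)%:E) by exact/measurable_EFinP.
have iMc : lebesgue_measure.-integrable `[x, y] (EFin \o cst M).
  apply: continuous_compact_integrable; first exact: segment_compact.
  by apply: continuous_subspaceT => t; exact: cvg_cst.
have iM : lebesgue_measure.-integrable `]x, y[ (EFin \o cst M).
  by apply: integrableS iMc => //; exact: subset_itv_oo_cc.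
have [] := @dominated_convergence _ _ _ (@lebesgue_measure R) `]x, y[ _
  (fun n => EFin \o d n) (EFin \o dp) (EFin \o cst M) md mdp.
- exact: measurable_itv.
- apply: aeW => t /= /limd dt; apply/fine_cvgP; split; first by near=> n.
  exact: dt.
- exact: iM.
- apply: aeW => t /= n txy; rewrite lee_fin /d normrM.
  have h0 : 0 < harmonic n :> R by exact: harmonic_gt0.
  rewrite normfV ler_pdivrMr ?normr_gt0 ?gt_eqF// (le_trans (qlip _ _))//.
  by rewrite addrAC subrr add0r.
move=> _ _ /=.
have -> : (fun n => \int[lebesgue_measure]_(t in `]x, y[) (d n t)%:E)%E =
   EFin \o (fun n => D n y - D n x).
  apply/funext => n /=; rewrite -intd; apply/esym; exact: integral_itv_bndoo.
move=> L; rewrite /Rintegral integral_itv_bndoo//.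
have L' : EFin (D n y - D n x) @[n --> \oo] --> (p y - p x)%:E.
  by apply/fine_cvgP; split; first by near=> n.
by have -> := cvg_unique (@ereal_hausdorff R) L L'.
Unshelve. all: by end_near. Qed.

(** * Functions differentiable relative to an interval *)

(** The usual hypothesis of the mean value theorem on every segment of [U].
    Unlike one-sided derivatives at the endpoints, it is handled directly by
    the calculus of two-sided derivatives. *)
Definition derivative_inside {R : realType} (U : set R) (F dF : R -> R) :=
  {within U, continuous F} /\ forall x, U^° x -> is_derive x 1 F (dF x).

Lemma derivable_in_continuous (R : realType) (U : set R) (f : R -> R) :
  (forall x, U x -> derivable_in U f x) -> {within U, continuous f}.
Proof.
move=> df; apply/subspace_continuousP => x Ux.
have /cvgrPdist_le /(_ 1 ltr01) := df _ Ux.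
set l := lim _; rewrite !near_withinE => near_quot.
apply/cvgrPdist_le => e e0; rewrite near_withinE.
near=> y => Uy.
have [->|yx] := eqVneq y x; first by rewrite subrr normr0 ltW.
have ql : y != x -> U y -> `|l - (f y - f x) / (y - x)| <= 1.
  by near: y; exact: near_quot.
move: ql => /(_ yx Uy) ql.
have yx0 : y - x != 0 by rewrite subr_eq0.
have -> : f x - f y = (l - (f y - f x) / (y - x) - l) * (y - x) by field.
rewrite normrM (@le_trans _ _ ((1 + `|l|) * `|y - x|))//.
  by rewrite ler_wpM2r// (le_trans (ler_normB _ _))// lerD2r.
rewrite mulrC -ler_pdivlMr ?ltr_pwDl// distrC; near: y.
by apply: cvgr_dist_le; [exact: cvg_id|rewrite divr_gt0// ltr_pwDl].
Unshelve. all: by end_near. Qed.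

Lemma derivable_in_interior (R : realType) (U : set R) (f : R -> R) (x : R) :
  U^° x -> derivable_in U f x -> is_derive x 1 f (derive_in U f x).
Proof.
move=> Uox dfx; have Ux : nbhs x U by [].
suff D : h^-1 *: ((f \o shift x) (h *: 1) - f x) @[h --> 0^'] --> derive_in U f x.
  by apply: DeriveDef; [apply/cvg_ex; exists (derive_in U f x)|exact: cvg_lim D].
apply/cvgrPdist_le => e e0.
have /cvgrPdist_le /(_ e e0) := dfx.
rewrite -/(derive_in U f x) !near_withinE => near_quot.
have : \forall y \near x, y - x != 0 ->
    `|derive_in U f x - (f y - f x) / (y - x)| <= e.
  move: near_quot; apply: filterS2 Ux => y Uy /= near_quot yx0.
  by apply: near_quot => //; rewrite -subr_eq0.
rewrite (near_shift 0) subr0; apply: filterS => h /=.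
by rewrite addrK /GRing.scale /= mulr1 mulrC.
Qed.

Lemma derivative_inside_derive_in (R : realType) (U : set R) (f : R -> R) :
  (forall x, U x -> derivable_in U f x) ->
  derivative_inside U f (derive_in U f).
Proof.
move=> df; split; first exact: derivable_in_continuous.
move=> x Ux; apply: derivable_in_interior => //.
exact/df/(interior_subset Ux).
Qed.

(** * Mean value theorem and primitives on an interval *)

Lemma is_interval_segment (R : realType) (U : set R) (u v : R) :
  is_interval U -> U u -> U v -> `[u, v] `<=` U /\ `]u, v[ `<=` U^°.
Proof.
move=> iU Uu Uv; have sub : `[u, v] `<=` U.
  by move=> t /=; rewrite in_itv/=; exact: iU.
by split => //; rewrite -(interior_itv_bnd u v true false); exact: interiorS.
Qed.

(** The two points are in no particular order, so that a step to the left and a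
    step to the right are treated alike. *)
Lemma mvt_inside (R : realType) (U : set R) (F dF : R -> R) (x y : R) :
  is_interval U -> derivative_inside U F dF -> U x -> U y ->
  exists c, [/\ U c, `|c - x| <= `|y - x| & F y - F x = dF c * (y - x)].
Proof.
move=> iU [cF FdF].
have main u v : u < v -> U u -> U v ->
    exists c, [/\ U c, u < c < v & F v - F u = dF c * (v - u)].
  move=> uv Uu Uv.
  have [sub subi] := is_interval_segment R U u v iU Uu Uv.
  have dFuv t (tuv : t \in `]u, v[) : is_derive t 1 F (dF t) by exact/FdF/subi.
  have cFuv : {within `[u, v], continuous F} by exact: continuous_subspaceW cF.
  have [c cuv E] := MVT uv dFuv cFuv.
  have Uc : U c by apply: interior_subset; exact: subi.
  by exists c; split => //; rewrite in_itv/= in cuv.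
move=> Ux Uy; have [xy|yx|<-] := ltgtP x y.
- have [c [Uc /andP[xc cy] E]] := main _ _ xy Ux Uy.
  by exists c; split => //; rewrite !gtr0_norm ?subr_gt0// lerD2r ltW.
- have [c [Uc /andP[yc cx] E]] := main _ _ yx Uy Ux.
  exists c; split => //; first by rewrite !ltr0_norm ?subr_lt0// lerN2 lerD2r ltW.
  by rewrite -(opprB (F x)) E -mulrN opprB.
- by exists x; split => //; rewrite !subrr mulr0.
Qed.

Lemma derivative_inside_lin (R : realType) (U : set R) (F dF G dG : R -> R)
    (a b : R) :
  derivative_inside U F dF -> derivative_inside U G dG ->
  derivative_inside U (fun t => a * F t - b * G t) (fun t => a * dF t - b * dG t).
Proof.
move=> [cF FdF] [cG GdG]; split => [x|x Ux].
  by apply: cvgB; apply: cvgMr; [exact: cF|exact: cG].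
have := FdF _ Ux; have := GdG _ Ux => dG' dF'.
have -> : (fun t => a * F t - b * G t) = a \*: F - b \*: G by [].
exact: is_derive_eq.
Qed.

Lemma derivative_inside_log (R : realType) (U : set R) (F dF : R -> R) :
  derivative_inside U F dF -> (forall x, U x -> F x != 0) ->
  derivative_inside U (fun t => ln `|F t|) (fun t => dF t / F t).
Proof.
move=> [cF FdF] F0.
(* Squaring avoids the sign of [F]; where [F] vanishes both sides are [0],
   as [ln] vanishes at [0]. *)
have -> : (fun t => ln `|F t|) = (fun t => 2^-1 * ln (F t ^+ 2)).
  apply/funext => t; have [->|Ft] := eqVneq (F t) 0.
    by rewrite normr0 expr0n/= ln0// mulr0.
  by rewrite -real_normK ?num_real// lnXn ?normr_gt0// -[ln _ *+ 2]mulr_natl mulKf ?pnatr_eq0.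
have sq0 x : U x -> 0 < F x ^+ 2 by move=> /F0 Fx; rewrite exprn_even_gt0.
split.
  apply/subspace_continuousP => x Ux; apply: cvgMr.
  have /subspace_continuousP/(_ x Ux) Fx := cF.
  apply: (@cvg_comp _ _ _ (fun t => F t ^+ 2) (@ln R) _ (nbhs (F x ^+ 2))).
    exact: (cvgM Fx Fx).
  exact/continuous_ln/sq0.
move=> x Ux; have Fdx := FdF x Ux.
have Fx := F0 _ (interior_subset Ux).
have d2 : is_derive x 1 (F * F) (F x *: dF x + F x *: dF x) by exact: is_deriveM.
have dl := is_derive1_ln (sq0 _ (interior_subset Ux)).
have dc : is_derive x 1 (@ln R \o (F * F)) ((F x ^+ 2)^-1 * (F x *: dF x + F x *: dF x)).
  exact: is_derive1_comp.
have -> : (fun t => 2^-1 * ln (F t ^+ 2)) = 2^-1 \*: (@ln R \o (F * F)) by [].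
apply: is_derive_eq; rewrite /GRing.scale/=; field.
by rewrite Fx.
Qed.

Lemma oriented_integral_derivative (R : realType) (U : set R) (p dp : R -> R)
    (M x y : R) :
  is_interval U -> derivative_inside U p dp -> (forall t, U t -> `|dp t| <= M) ->
  U x -> U y -> oriented_integral dp x y = p y - p x.
Proof.
move=> iU [cp pdp] dpM.
have main u v : u < v -> U u -> U v ->
    \int[lebesgue_measure]_(t in `[u, v]) dp t = p v - p u.
  move=> uv Uu Uv.
  have [sub subi] := is_interval_segment R U u v iU Uu Uv.
  apply: (@Rintegral_derivative R p dp u v M) => //.
  - exact: continuous_subspaceW cp.
  - by move=> t /subi; exact: pdp.
  - by move=> t /subi/interior_subset; exact: dpM.
move=> Ux Uy; rewrite /oriented_integral.
have [xy|yx|<-] := ltgtP x y.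
- exact: main.
- by rewrite main// opprB.
- by rewrite set_itv1 Rintegral_set1 subrr.
Qed.

(** * Consequences of membership in the class S *)

Section S_class_facts.
Context {R : realType} (U : set R).
Hypothesis iU : is_interval U.

Lemma S_class_derivative_inside f : S_class U f ->
  derivative_inside U f (derive_in U f) /\
  derivative_inside U (fun t => ln `|derive_in U f t|) (P_op U f).
Proof.
move=> Sf; split.
  by apply: derivative_inside_derive_in => x /Sf[].
apply: derivative_inside_log; last by move=> x /Sf[].
by apply: derivative_inside_derive_in => x /Sf[].
Qed.

Lemma S_class_inj f : S_class U f -> {in U &, injective f}.
Proof.
move=> Sf x y; rewrite !inE => Ux Uy fxy.
have [c [Uc _]] := mvt_inside R U _ _ x y iU (S_class_derivative_inside f Sf).1 Ux Uy.
rewrite fxy subrr => /esym/eqP; rewrite mulf_eq0 subr_eq0.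
by have [_ _ /negPf -> /= /eqP->] := Sf c Uc.
Qed.

(** The derivative is itself differentiable, hence continuous, and it has no
    zero to pass through. *)
Lemma S_class_same_sign f s t : S_class U f -> U s -> U t ->
  0 < derive_in U f s * derive_in U f t.
Proof.
move=> Sf; wlog : s t / s <= t.
  move=> H Us Ut; have [st|/ltW ts] := leP s t; first exact: H.
  by rewrite mulrC; exact: H.
move=> st Us Ut; rewrite ltNge; apply/negP => le0.
have [sub _] := is_interval_segment R U s t iU Us Ut.
have cf : {within `[s, t], continuous (derive_in U f)}.
  by apply: (continuous_subspaceW sub); apply: derivable_in_continuous => x /Sf[].
have [] := @IVT R (derive_in U f) s t 0 st cf.
  have [s0|s0] := leP (derive_in U f s) 0; have [t0|t0] := leP (derive_in U f t) 0.
  - have [_ _ fs] := Sf s Us; have [_ _ ft] := Sf t Ut.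
    have s0' : derive_in U f s < 0 by rewrite lt_neqAle fs.
    have t0' : derive_in U f t < 0 by rewrite lt_neqAle ft.
    by move: le0; rewrite leNgt nmulr_rgt0// t0'.
  - by rewrite ge_min le_max s0 (ltW t0) orbT.
  - by rewrite ge_min le_max t0 (ltW s0) orbT.
  - by move: le0; rewrite leNgt mulr_gt0.
move=> c /sub/= Uc fc0.
by have [_ _] := Sf c Uc; rewrite fc0 eqxx.
Qed.

Lemma S_bounded_P K f x : S_bounded K U f -> U x -> `|P_op U f x| <= K.
Proof.
move=> [_ fK] Ux; rewrite -lee_fin; apply: le_trans fK.
by apply: ereal_sup_ubound; exists x.
Qed.

End S_class_facts.

(** * The star norm as an oscillation *)

(** When [dp] is the bounded derivative of [p], its star norm is the
    oscillation of [p], and it is finite because [U] is bounded. *)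
Section starnorm_facts.
Context {R : realType} (U : set R) (p dp : R -> R) (M : R).
Hypotheses (iU : is_interval U) (bU : bounded_set U)
  (pdp : derivative_inside U p dp) (dpM : forall t, U t -> `|dp t| <= M).

Lemma interval_length_ge x y : U x -> U y -> `|y - x| <= interval_length U.
Proof.
move=> Ux Uy; case: bU => B [_ BU].
have {}BU z : U z -> `|z| <= B + 1 by move=> Uz; apply: BU => //; rewrite ltrDl.
have hs : has_ubound U by exists (B + 1) => z /BU; exact: le_trans (ler_norm _).
have hi : has_lbound U.
  by exists (- (B + 1)) => z /BU; rewrite ler_norml => /andP[].
have := ub_le_sup hs Ux; have := ub_le_sup hs Uy.
have := ge_inf hi Ux; have := ge_inf hi Uy.
by rewrite /interval_length ler_norml; move=> *; apply/andP; split; lra.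
Qed.

Lemma increment_le x y : U x -> U y -> `|p y - p x| <= M * interval_length U.
Proof.
move=> Ux Uy; have [c [Uc _ ->]] := mvt_inside R U p dp x y iU pdp Ux Uy.
by rewrite normrM ler_pM// ?dpM// interval_length_ge.
Qed.

Lemma starnorm_fin (x0 : R) : U x0 -> starnorm U dp \is a fin_num.
Proof.
move=> Ux0; apply/fin_real/andP; split.
  apply: (@lt_le_trans _ _ 0%E); first by [].
  apply: ereal_sup_ubound; exists x0, x0; split => //.
  by rewrite (oriented_integral_derivative R U p dp M)// subrr normr0.
apply: (@le_lt_trans _ _ (M * interval_length U)%:E); last exact: ltry.
apply: ge_ereal_sup => _ [x [y [Ux Uy ->]]].
by rewrite (oriented_integral_derivative R U p dp M)// lee_fin increment_le.
Qed.

Lemma increment_le_starnorm x y : U x -> U y ->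
  `|p y - p x| <= fine (starnorm U dp).
Proof.
move=> Ux Uy; rewrite -lee_fin fineK; last exact: starnorm_fin Ux.
apply: ereal_sup_ubound; exists x, y; split => //.
by rewrite (oriented_integral_derivative R U p dp M).
Qed.

Lemma increment_gt_starnorm (c x0 : R) : U x0 -> c < fine (starnorm U dp) ->
  exists x y, [/\ U x, U y & c < `|p y - p x|].
Proof.
move=> Ux0; rewrite -lte_fin fineK; last exact: starnorm_fin Ux0.
move=> /ereal_sup_gt[_ [x [y [Ux Uy ->]]]].
rewrite (oriented_integral_derivative R U p dp M)// lte_fin => cxy.
by exists x, y.
Qed.

End starnorm_facts.

(** * Means of two points *)

Lemma qameanE (R : realType) (U : set R) (f : R -> R) n (a w : 'I_n -> R) (x : R) :
  {in U &, injective f} -> U x -> \sum_(i < n) w i * f (a i) = f x ->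
  qamean U f a w = x.
Proof.
by move=> injf Ux E; rewrite /qamean E pinvKV// inE.
Qed.

Lemma qadist_two_point (R : realType) (U : set R) (f g : R -> R) (a b w x y : R) :
  {in U &, injective f} -> {in U &, injective g} ->
  U a -> U b -> U x -> U y -> 0 < w < 1 ->
  (1 - w) * f a + w * f b = f x -> (1 - w) * g a + w * g b = g y ->
  (`|x - y|%:E <= qadist U f g)%E.
Proof.
move=> injf injg Ua Ub Ux Uy /andP[w0 w1] fx gy.
pose pt (i : 'I_2) := if i == ord0 then a else b.
pose wt (i : 'I_2) := if i == ord0 then 1 - w else w.
apply: ereal_sup_ubound; exists 2%N, pt, wt; split.
- by move=> i; rewrite /pt; case: ifP.
- by move=> i; rewrite /wt; case: ifP => //; rewrite subr_gt0.
- by rewrite !big_ord_recl big_ord0 /wt /=; ring.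
- rewrite (qameanE R U f _ _ _ x)// ?(qameanE R U g _ _ _ y)//.
  + by rewrite !big_ord_recl big_ord0 /wt /pt/= addr0.
  + by rewrite !big_ord_recl big_ord0 /wt /pt/= addr0.
Qed.

Lemma qadist_ge0 (R : realType) (U : set R) (f g : R -> R) (x : R) :
  U x -> (0 <= qadist U f g)%E.
Proof.
move=> Ux; apply: (@le_trans _ _ `|qamean U f (fun=> x : R) (fun _ : 'I_1 => 1)
   - qamean U g (fun=> x) (fun _ : 'I_1 => 1)|%:E); first by rewrite lee_fin.
apply: ereal_sup_ubound; exists 1%N, (fun=> x), (fun=> 1); split => //.
by rewrite big_ord_recl big_ord0 addr0.
Qed.

(** * The gap between the two normalised functions *)

(** For [z < 0] the difference is at least [exp m - 1], which dominates
    [1 - exp (- m)]; so only the size of the logarithm of a ratio matters. *)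
Lemma expR_gap (R : realType) (m z : R) : 0 <= m -> m <= `|z| ->
  1 - expR (- m) <= `|1 - expR (- z)|.
Proof.
move=> m0; rewrite ler_normr => /orP[mz|mz].
  by apply: le_trans (ler_norm _); rewrite lerD2l lerN2 ler_expR lerN2.
rewrite distrC; apply: le_trans (ler_norm _).
have : expR m <= expR (- z) by rewrite ler_expR.
have := expR_ge1Dx m; have := expR_ge1Dx (- m); lra.
Qed.

(** Normalisation by [f b - f a] makes the derivative positive whether [f]
    increases or decreases. *)
Lemma normalized_slope (R : realType) (U : set R) (f : R -> R) (a b t : R) :
  is_interval U -> S_class U f -> U a -> U b -> a < b -> U t ->
  f b - f a != 0 /\ (f b - f a)^-1 * derive_in U f t =
    expR (ln `|derive_in U f t| - ln `|f b - f a|).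
Proof.
move=> iU Sf Ua Ub ab Ut.
have [c [Uc _ Ac]] :=
  mvt_inside R U _ _ a b iU (S_class_derivative_inside U f Sf).1 Ua Ub.
set A := f b - f a in Ac *.
have At : 0 < A * derive_in U f t.
  by rewrite Ac mulrAC mulr_gt0 ?subr_gt0// (S_class_same_sign U).
have A0 : A != 0 by apply/eqP => A0; rewrite A0 mul0r ltxx in At.
have [_ _ ft0] := Sf t Ut.
split => //; rewrite expRD expRN !lnK ?posrE ?normr_gt0//.
have {1}-> : A^-1 = A / A ^+ 2 by field.
rewrite mulrAC -(gtr0_norm At) normrM -real_normK ?num_real//; field.
by rewrite normr_eq0.
Qed.

(** Combines the two estimates of one gap: [lx - lA] and [lz - lA] are the
    logarithms of the slope of [F] at the points that they use. *)
Lemma slope_ratio_gap (R : realType) (lx lz lA k d N D : R) :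
  0 <= k -> 0 <= d -> lz - lx <= N ->
  expR (lx - lA) * k * d <= expR (lz - lA) * D -> d * k * expR (- N) <= D.
Proof.
move=> k0 d0 lN gap; rewrite -(ler_pM2l (expR_gt0 (lz - lA))).
apply: le_trans gap.
have -> : expR (lz - lA) * (d * k * expR (- N)) =
    expR (lz - lA - N) * (k * d) by rewrite (expRD _ (- N)); ring.
by rewrite -mulrA ler_wpM2r ?mulr_ge0// ler_expR; lra.
Qed.

Lemma half_le_of_le_add (R : realType) (c u v : R) :
  c <= u + v -> (c / 2 <= u) || (c / 2 <= v).
Proof. by move=> cuv; case: (leP (c / 2) u) => //= ?; lra. Qed.

Lemma quarter_steps (R : realType) (a b d : R) : 0 < d -> d <= (b - a) / 4 ->
  (a < a + d < b) /\ (a < b - d < b).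
Proof. by move=> d0 dab; split; apply/andP; split; lra. Qed.

Section two_point.
Context {R : realType} (U : set R) (K : R) (f g : R -> R) (a b : R).
Hypotheses (iU : is_interval U) (K0 : 0 < K)
  (hf : S_bounded K U f) (hg : S_bounded K U g)
  (Ua : U a) (Ub : U b) (ab : a < b).

Let A := f b - f a.
Let B := g b - g a.
Let h t := ln `|derive_in U f t| - ln `|derive_in U g t|.
Let Phi t := A^-1 * f t - B^-1 * g t.

Lemma log_ratio_inside : derivative_inside U h (P_op U f \- P_op U g).
Proof.
have [_ df] := S_class_derivative_inside U f hf.1.
have [_ dg] := S_class_derivative_inside U g hg.1.
have := derivative_inside_lin R U _ _ _ _ 1 1 df dg.
under eq_fun do rewrite !mul1r.
by under [X in derivative_inside _ _ X -> _]eq_fun do rewrite !mul1r.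
Qed.

Lemma P_opB_le t : U t -> `|(P_op U f \- P_op U g) t| <= 2 * K.
Proof.
move=> Ut; rewrite /= (le_trans (ler_normB _ _))// mulr_natl mulr2n.
by rewrite lerD// (S_bounded_P U K).
Qed.

(** With [F] and [G] the normalisations of [f] and [g], [Phi] is [F - G] up to
    an additive constant.  Its derivative is [F' * (1 - exp (- (h - c)))], and
    the step from [e] to [e'] is so short that [|h - c|] drops at most from
    [eta / 2] to [eta / 4]. *)
Lemma normalized_gap (eta e e' : R) : 0 <= eta -> U e -> U e' ->
  `|e' - e| = eta / (8 * K) ->
  eta / 2 <= `|h e - (ln `|A| - ln `|B|)| ->
  exists2 xi, U xi & A^-1 * derive_in U f xi * (1 - expR (- (eta / 4)))
     * (eta / (8 * K)) <= `|Phi e' - Phi e|.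
Proof.
move=> eta0 Ue Ue' ee' he.
have [df _] := S_class_derivative_inside U f hf.1.
have [dg _] := S_class_derivative_inside U g hg.1.
have dPhi := derivative_inside_lin R U _ _ _ _ A^-1 B^-1 df dg.
have [xi [Uxi xie E]] := mvt_inside R U _ _ e e' iU dPhi Ue Ue'.
exists xi => //; rewrite {}E normrM ee' ler_wpM2r ?divr_ge0 ?mulr_ge0 ?(ltW K0)//.
have [_ rE] := normalized_slope R U f a b xi iU hf.1 Ua Ub ab Uxi.
have [_ sE] := normalized_slope R U g a b xi iU hg.1 Ua Ub ab Uxi.
have {sE}-> : B^-1 * derive_in U g xi =
    A^-1 * derive_in U f xi * expR (- (h xi - (ln `|A| - ln `|B|))).
  by rewrite rE sE -expRD /h; congr expR; rewrite -/A -/B; ring.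
rewrite -{2}(mulr1 (A^-1 * _)) -mulrBr normrM [X in X * _ <= _]rE.
rewrite [X in _ <= `|X| * _]rE (gtr0_norm (expR_gt0 _)).
rewrite ler_wpM2l ?expR_ge0//; apply: expR_gap; first by rewrite divr_ge0.
have [c [Uc _ hc]] := mvt_inside R U _ _ e xi iU log_ratio_inside Ue Uxi.
have hxi : `|h xi - h e| <= eta / 4.
  rewrite hc normrM (le_trans (ler_pM _ _ (P_opB_le c Uc) xie))// ee'.
  suff -> : 2 * K * (eta / (8 * K)) = eta / 4 by [].
  by field; rewrite gt_eqF.
have := ler_distD (h xi) (h e) (ln `|A| - ln `|B|).
rewrite (distrC (h e) (h xi)) => tri.
have -> : eta / 4 = eta / 2 - eta / 4 by field.
by rewrite lerBlDl (le_trans he)// (le_trans tri)// lerD2r.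
Qed.

(** The weight [w = G y] makes [y] the [g]-mean of [a] and [b]; then the
    [f]-mean [x] satisfies [F x = G y], so that [F y - F x] is the gap between
    [F] and [G] at [y]. *)
Lemma two_point_mean_gap (y : R) : U y -> a < y < b ->
  exists x zeta, [/\ U x, U zeta, (`|x - y|%:E <= qadist U f g)%E
    & `|Phi y - Phi a| = A^-1 * derive_in U f zeta * `|x - y|].
Proof.
move=> Uy /andP[ay yb].
have Sf := hf.1; have Sg := hg.1.
have [df _] := S_class_derivative_inside U f Sf.
have [dg _] := S_class_derivative_inside U g Sg.
have [A0 _] := normalized_slope R U f a b a iU Sf Ua Ub ab Ua.
have [B0 _] := normalized_slope R U g a b a iU Sg Ua Ub ab Ua.
have incr u v : U u -> U v -> u < v -> 0 < B^-1 * (g v - g u).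
  move=> Uu Uv uv; have [c [Uc _ ->]] := mvt_inside R U _ _ u v iU dg Uu Uv.
  have [_ sE] := normalized_slope R U g a b c iU Sg Ua Ub ab Uc.
  by rewrite mulrA sE mulr_gt0 ?expR_gt0 ?subr_gt0.
set w := B^-1 * (g y - g a).
have w01 : 0 < w < 1.
  rewrite incr//= -subr_gt0; have := incr _ _ Uy Ub yb.
  suff -> : 1 - w = B^-1 * (g b - g y) by [].
  by rewrite /w -(mulVf B0) -mulrBr; congr (_ * _); rewrite /B; ring.
have [sub _] := is_interval_segment R U a b iU Ua Ub.
have cf : {within `[a, b], continuous f} by exact: continuous_subspaceW df.1.
have [|x xab fx] := @IVT R f a b ((1 - w) * f a + w * f b) (ltW ab) cf.
  have /andP[w0 w1] := w01.
  rewrite ge_min le_max; have [fab|/ltW fba] := leP (f a) (f b).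
    by apply/andP; split; apply/orP; [left|right]; nra.
  by apply/andP; split; apply/orP; [right|left]; nra.
have Ux : U x by exact: sub.
have [zeta [Uz _ E]] := mvt_inside R U _ _ x y iU df Ux Uy.
exists x, zeta; split => //.
  apply: (qadist_two_point R U f g a b w) => //; try exact: (S_class_inj U iU).
  by rewrite /w /B; field.
have [_ rE] := normalized_slope R U f a b zeta iU Sf Ua Ub ab Uz.
have -> : Phi y - Phi a = A^-1 * derive_in U f zeta * (y - x).
  rewrite -mulrA -E fx.
  have -> : f y - ((1 - w) * f a + w * f b) = f y - f a - w * A by rewrite /A; ring.
  by rewrite mulrBr (mulrCA A^-1 w) mulVf// mulr1 /Phi /w; ring.
rewrite normrM distrC; congr (_ * _).
by rewrite [X in `|X|]rE gtr0_norm ?expR_gt0// rE.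
Qed.

(** The constant [c] cannot be closer than [eta / 2] to both [h a] and [h b]; one
    endpoint therefore serves as [e], and [y] is the point at distance [d] inside. *)
Lemma qadist_lower (N eta : R) : eta = `|h b - h a| ->
  (forall s t, U s -> U t ->
    `|ln `|derive_in U f t| - ln `|derive_in U f s| | <= N) ->
  0 < eta ->
  ((eta / (8 * K) * (1 - expR (- (eta / 4))) * expR (- N))%:E <= qadist U f g)%E.
Proof.
move=> etaE hN eta0; set c := ln `|A| - ln `|B|.
set d := eta / (8 * K).
have d0 : 0 < d by rewrite divr_gt0// mulr_gt0.
(* The step stays inside the segment because [h] is [2K]-Lipschitz. *)
have dab : d <= (b - a) / 4.
  have [x [Ux _ hx]] := mvt_inside R U _ _ a b iU log_ratio_inside Ua Ub.
  rewrite /d ler_pdivrMr ?mulr_gt0// etaE hx normrM (gtr0_norm (_ : 0 < b - a)) ?subr_gt0//.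
  have -> : (b - a) / 4 * (8 * K) = 2 * K * (b - a) by field.
  by rewrite ler_wpM2r ?subr_ge0 ?(ltW ab)// P_opB_le.
have [A0 _] := normalized_slope R U f a b a iU hf.1 Ua Ub ab Ua.
have [B0 _] := normalized_slope R U g a b a iU hg.1 Ua Ub ab Ua.
have Phiab : Phi b = Phi a.
  apply/eqP; rewrite -subr_eq0; apply/eqP.
  have -> : Phi b - Phi a = A^-1 * A - B^-1 * B by rewrite /Phi /A /B; ring.
  by rewrite !mulVf// subrr.
have [e [y [Ue Uy aby ey [Phie he]]]] : exists e y, [/\ U e, U y, a < y < b,
    `|y - e| = d & Phi e = Phi a /\ eta / 2 <= `|h e - c|].
  have tri := ler_distD c (h b) (h a).
  rewrite -etaE addrC (distrC c) in tri.
  have /orP[ha|hb] := half_le_of_le_add R eta _ _ tri.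
  - have [aby _] := quarter_steps R a b d d0 dab.
    have Uy : U (a + d) by apply: (iU _ _ Ua Ub); have /andP[/ltW-> /ltW->] := aby.
    by exists a, (a + d); split => //; rewrite addrAC subrr add0r gtr0_norm.
  - have [_ aby] := quarter_steps R a b d d0 dab.
    have Uy : U (b - d) by apply: (iU _ _ Ua Ub); have /andP[/ltW-> /ltW->] := aby.
    by exists b, (b - d); split => //; rewrite addrAC subrr add0r normrN gtr0_norm.
have [xi Uxi gap] := normalized_gap eta e y (ltW eta0) Ue Uy ey he.
have [x [zeta [Ux Uz rho mean]]] := two_point_mean_gap y Uy aby.
apply: le_trans rho; rewrite lee_fin.
rewrite Phie {}mean in gap.
have [_ xiE] := normalized_slope R U f a b xi iU hf.1 Ua Ub ab Uxi.
have [_ zE] := normalized_slope R U f a b zeta iU hf.1 Ua Ub ab Uz.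
rewrite xiE zE in gap.
apply: slope_ratio_gap gap.
- by rewrite subr_ge0 -expR0 ler_expR oppr_le0 divr_ge0// ltW.
- exact: ltW.
- exact: le_trans (ler_norm _) (hN _ _ Uxi Uz).
Qed.

End two_point.

(** * Comparison of the constants *)

(** In terms of [z = exp (eps / 12)] the left side is
    [eps (z^3 - 1) (z^2 - 1)].  On the right [exp L - 1 >= z^6 - 1], which
    absorbs [z^3 - 1] and leaves a factor [z^3 + 1 >= z^2]; that factor turns
    [1 - z^-2] into [z^2 - 1].  The constant [2 / 3] is what makes
    [eta / 4 >= eps / 6]. *)
Lemma constant_compare (R : realType) (eps eta L : R) :
  0 <= eps -> 2 / 3 * eps <= eta -> eps <= 2 * L ->
  eps * (expR (eps / 4) - 1) * (expR (eps / 6) - 1) <=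
  2 * eta * (1 - expR (- (eta / 4))) * (expR L - 1).
Proof.
move=> eps0 leeta epsL.
set z := expR (eps / 12).
have z1 : 1 <= z by rewrite -expR0 ler_expR divr_ge0.
have -> : expR (eps / 4) = z ^+ 3.
  by rewrite -expRM_natl; congr expR; field.
have E6 : expR (eps / 6) = z ^+ 2.
  by rewrite -expRM_natl; congr expR; field.
rewrite E6; set u := 1 - expR (- (eps / 6)).
have uz : u * z ^+ 2 = z ^+ 2 - 1.
  by rewrite -E6 mulrBl mul1r expRN mulVf// gt_eqF ?expR_gt0.
have u0 : 0 <= u by rewrite subr_ge0 -expR0 ler_expR oppr_le0 divr_ge0.
have leu : u <= 1 - expR (- (eta / 4)) by rewrite lerD2l lerN2 ler_expR; lra.
have leL : (z ^+ 3 - 1) * (z ^+ 3 + 1) <= expR L - 1.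
  have -> : (z ^+ 3 - 1) * (z ^+ 3 + 1) = z ^+ 6 - 1 by ring.
  by rewrite lerD2r -expRM_natl ler_expR; lra.
have z32 : z ^+ 2 <= z ^+ 3 by rewrite ler_weXn2l.
have z21 : 1 <= z ^+ 2 by rewrite exprn_ege1.
have z31 : 0 <= z ^+ 3 - 1 by lra.
apply: (@le_trans _ _ (2 * (2 / 3 * eps) * u * ((z ^+ 3 - 1) * (z ^+ 3 + 1)))); last first.
  rewrite ler_pM//; last by rewrite ler_pM// ?mulr_ge0// ler_pM2l.
    by rewrite !mulr_ge0.
  by rewrite mulr_ge0//; lra.
rewrite -uz.
have -> : 2 * (2 / 3 * eps) * u * ((z ^+ 3 - 1) * (z ^+ 3 + 1)) =
  (eps * (z ^+ 3 - 1) * u) * (4 / 3 * (z ^+ 3 + 1)) by field.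
by rewrite mulrA ler_wpM2l// ?mulr_ge0//; lra.
Qed.

(** * The lower bound *)

Theorem theorem1 (R : realType) (U : set R) (K : R) (f g : R -> R)
    (hU : nondegenerate_interval U) (bU : bounded_set U) (hK : 0 < K)
    (hf : S_bounded K U f) (hg : S_bounded K U g) :
  let eps := fine (starnorm U (P_op U f \- P_op U g)) in
  ((eps * (expR (eps / 4) - 1) * (expR (eps / 6) - 1)
    / (16 * K * expR (fine (starnorm U (P_op U f)))
       * (expR (K * interval_length U) - 1)))%:E
   <= qadist U f g)%E.
Proof.
cbv zeta; set eps := fine (starnorm U (P_op U f \- P_op U g)).
have [iU [u [v [Uu Uv uv]]]] := hU.
have [_ df] := S_class_derivative_inside U f hf.1.
have fK x : U x -> `|P_op U f x| <= K by exact: S_bounded_P.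
have dh := log_ratio_inside U K f g hf hg.
have hK2 := P_opB_le U K f g hf hg.
have incr := increment_le_starnorm U _ _ _ iU bU dh hK2.
set h := fun t => _ in dh incr.
have eps0 : 0 <= eps by apply: le_trans (incr u u Uu Uu).
have len0 : 0 < interval_length U.
  apply: lt_le_trans (interval_length_ge U bU u v Uu Uv).
  by rewrite normr_gt0 subr_eq0 gt_eqF.
have L0 : 0 < expR (K * interval_length U) - 1.
  by rewrite subr_gt0 -expR0 ltr_expR mulr_gt0.
(* For [eps = 0] there is no pair of distinct points to choose. *)
move: eps0; rewrite le_eqVlt => /predU1P[<-|eps0].
  by rewrite !mul0r; exact: qadist_ge0 Uu.
have epsL : eps <= 2 * (K * interval_length U).
  rewrite leNgt; apply/negP => /(increment_gt_starnorm U _ _ _ iU bU dh hK2 _ u Uu).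
  move=> [x [y [Ux Uy]]].
  by rewrite mulrA ltNge (increment_le U _ _ _ iU bU dh hK2).
have lt23 : 2 / 3 * eps < eps by lra.
have [a [b [Ua Ub ab etagt]]] : exists a b, [/\ U a, U b, a < b
    & 2 / 3 * eps < `|h b - h a|].
  have [x [y [Ux Uy xy]]] := increment_gt_starnorm U _ _ _ iU bU dh hK2 _ u Uu lt23.
  have [lxy|lyx|exy] := ltgtP x y; first by exists x, y.
    by exists y, x; rewrite distrC.
  by move: xy; rewrite exy subrr normr0; lra.
have hN := increment_le_starnorm U _ _ _ iU bU df fK.
set N := fine (starnorm U (P_op U f)) in hN *.
have eta0 : 0 < `|h b - h a| by lra.
apply: le_trans
  (qadist_lower U K f g a b iU hK hf hg Ua Ub ab N _ erefl hN eta0).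
rewrite lee_fin; set eta := `|h b - h a|; rewrite -/(h b) -/(h a) -/eta.
have := constant_compare R eps eta _ (ltW eps0) (ltW etagt) epsL.
set c := _ - 1 in L0 *; set k := 1 - _.
rewrite ler_pdivrMr ?mulr_gt0 ?expR_gt0// => cmp.
apply: le_trans cmp _; rewrite expRN.
suff -> : eta / (8 * K) * k / expR N * (16 * K * expR N * c) = 2 * eta * k * c by [].
by field; rewrite !gt_eqF ?expR_gt0.
Qed.
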